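(* Let $\mathcal{C}$ be a rigid monoidal category, let $\mathcal{D}$ be a monoidal category and let $G\colon \mathcal{C}\to\mathcal{D}$ be a strong monoidal functor. If $G\dashv R$ is an adjunction, then the right adjoint $R$ induces a braided lax monoidal functor $\mathcal{Z}(R)\colon \mathcal{Z}(\mathcal{D})\to\mathcal{Z}(\mathcal{C})$ between Drinfeld centers.
   Context: Conventions: monoidal categories are written as if strict. A monoidal category is rigid if every object has a left and a right dual. A lax monoidal functor $F$ has structure maps $\mathrm{lax}^F_{X,Y}\colon FX\otimes FY\to F(X\otimes Y)$ (natural) and $\mathrm{lax}^F_0\colon \mathbb{1}\to F\mathbb{1}$ satisfying associativity and unitality; it is strong if these are invertible, and then $\mathrm{oplax}^F$ denotes the inverses. A lax monoidal functor $F$ between braided monoidal categories (braidings $\Psi$) is braided if $\mathrm{lax}_{Y,X}\circ\Psi_{FX,FY}=F(\Psi_{X,Y})\circ\mathrm{lax}_{X,Y}$ for all $X,Y$. The right adjoint $R$ of the strong monoidal functor $G$ carries the unique lax monoidal structure for which the unit and counit of $G\dashv R$ are monoidal transformations: $\mathrm{lax}^R_{X,Y}=R(\mathrm{counit}_X\otimes\mathrm{counit}_Y)\circ R(\mathrm{oplax}^G_{RX,RY})\circ\mathrm{unit}_{RX\otimes RY}$ and $\mathrm{lax}^R_0=R(\mathrm{oplax}^G_0)\circ\mathrm{unit}_{\mathbb{1}}$. The Drinfeld center $\mathcal{Z}(\mathcal{C})$ has objects $(X,c)$ with $X\in\mathcal{C}$ and $c=(c_A\colon X\otimes A\xrightarrow{\sim}A\otimes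 X)_{A\in\mathcal{C}}$ a natural isomorphism (half-braiding) with $c_{A\otimes B}=(A\otimes c_B)(c_A\otimes B)$ and $c_{\mathbb{1}}=\mathrm{id}$; morphisms are morphisms of $\mathcal{C}$ commuting with half-braidings; $(X,c)\otimes(Y,d)=(X\otimes Y,(c_A\otimes Y)(X\otimes d_A))$; the braiding is $\Psi_{(X,c),(Y,d)}=c_Y$. ''$R$ induces $\mathcal{Z}(R)$'' means: $\mathcal{Z}(R)(X,c)=(RX,c^R)$, where, for $A\in\mathcal{C}$, $c^R_A=(\mathrm{lproj}_{A,X})^{-1}\circ R(c_{GA})\circ\mathrm{rproj}_{X,A}$, with $\mathrm{lproj}_{A,X}=\mathrm{lax}^R_{GA,X}\circ(\mathrm{unit}_A\otimes RX)\colon A\otimes RX\to R(GA\otimes X)$ and $\mathrm{rproj}_{X,A}=\mathrm{lax}^R_{X,GA}\circ(RX\otimes\mathrm{unit}_A)\colon RX\otimes A\to R(X\otimes GA)$; $\mathcal{Z}(R)$ acts as $R$ on morphisms, and its lax monoidal structure is that of $R$. In particular, part of the assertion is that the inverse morphisms occurring here exist. *)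

(* Defs.v *)
From Corelib Require Import ssreflect ssrfun.
From Stdlib Require Import ProofIrrelevance.
Set Implicit Arguments.
Unset Strict Implicit.
Unset Printing Implicit Defensive.

Declare Scope cat_scope.
Delimit Scope cat_scope with cat.
Local Open Scope cat_scope.

(* Monoidal categories are not assumed to be strict: formulas that are usually
   written as if in a strict category have their associators and unitors
   inserted.  Morphisms are compared by Leibniz equality. *)

Record category := Category {
  ob :> Type;
  hom : ob -> ob -> Type;
  idm : forall X, hom X X;
  comp : forall X Y Z, hom Y Z -> hom X Y -> hom X Z;
  comp_idl : forall X Y (f : hom X Y), comp (idm Y) f = f;
  comp_idr : forall X Y (f : hom X Y), comp f (idm X) = f;
  compA : forall W X Y Z (h : hom Y Z) (g : hom X Y) (f : hom W X),
    comp h (comp g f) = comp (comp h g) f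
}.
Arguments hom {c} X Y.
Arguments idm {c} X.
Arguments comp {c X Y Z} g f : rename.

Notation "g ∘ f" := (comp g f) (at level 40, left associativity) : cat_scope.

Definition inverse_pair (C : category) (X Y : C) (f : hom X Y) (g : hom Y X)
  : Prop := g ∘ f = idm X /\ f ∘ g = idm Y.

Definition is_iso (C : category) (X Y : C) (f : hom X Y) : Prop :=
  exists g : hom Y X, inverse_pair f g.

Record monoidal_category := MonoidalCategory {
  mcat :> category;
  munit : mcat;
  tens : mcat -> mcat -> mcat;
  tensm : forall X X' Y Y' : mcat,
    hom X X' -> hom Y Y' -> hom (tens X Y) (tens X' Y');
  assoc : forall X Y Z, hom (tens (tens X Y) Z) (tens X (tens Y Z));
  associ : forall X Y Z, hom (tens X (tens Y Z)) (tens (tens X Y) Z);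
  lunit : forall X, hom (tens munit X) X;
  luniti : forall X, hom X (tens munit X);
  runit : forall X, hom (tens X munit) X;
  runiti : forall X, hom X (tens X munit);
  tensm_id : forall X Y, tensm (idm X) (idm Y) = idm (tens X Y);
  tensm_comp : forall (X X' X'' Y Y' Y'' : mcat)
      (g : hom X' X'') (f : hom X X') (k : hom Y' Y'') (h : hom Y Y'),
    tensm (g ∘ f) (k ∘ h) = tensm g k ∘ tensm f h;
  assocP : forall X Y Z, inverse_pair (assoc X Y Z) (associ X Y Z);
  lunitP : forall X, inverse_pair (lunit X) (luniti X);
  runitP : forall X, inverse_pair (runit X) (runiti X);
  assoc_nat : forall (X X' Y Y' Z Z' : mcat)
      (f : hom X X') (g : hom Y Y') (h : hom Z Z'),
    assoc X' Y' Z' ∘ tensm (tensm f g) h = tensm f (tensm g h) ∘ assoc X Y Z;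
  lunit_nat : forall (X Y : mcat) (f : hom X Y),
    lunit Y ∘ tensm (idm munit) f = f ∘ lunit X;
  runit_nat : forall (X Y : mcat) (f : hom X Y),
    runit Y ∘ tensm f (idm munit) = f ∘ runit X;
  triangle : forall X Y,
    tensm (idm X) (lunit Y) ∘ assoc X munit Y = tensm (runit X) (idm Y);
  pentagon : forall W X Y Z,
    assoc W X (tens Y Z) ∘ assoc (tens W X) Y Z =
    tensm (idm W) (assoc X Y Z) ∘ assoc W (tens X Y) Z
      ∘ tensm (assoc W X Y) (idm Z)
}.
Arguments munit {m}.
Arguments tens {m} X Y.
Arguments tensm {m X X' Y Y'} f g : rename.
Arguments assoc {m} X Y Z.
Arguments associ {m} X Y Z.
Arguments lunit {m} X.
Arguments luniti {m} X.
Arguments runit {m} X.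
Arguments runiti {m} X.

Notation "𝟙" := munit : cat_scope.
Notation "X ⊗ Y" := (tens X Y) (at level 38, left associativity) : cat_scope.
Notation "f ⊗₁ g" := (tensm f g) (at level 38, left associativity) : cat_scope.
Notation "X ◁ f" := (tensm (idm X) f)
  (at level 37, right associativity) : cat_scope.
Notation "f ▷ X" := (tensm f (idm X)) (at level 38, left associativity)
  : cat_scope.

(* L is a left dual of X; equivalently, X is a right dual of L. *)
Definition dual_pair (C : monoidal_category) (L X : C) : Prop :=
  exists (ev : hom (L ⊗ X) 𝟙) (coev : hom 𝟙 (X ⊗ L)),
    runit X ∘ (X ◁ ev) ∘ assoc X L X ∘ (coev ▷ X) ∘ luniti X = idm X /\
    lunit L ∘ (ev ▷ L) ∘ associ L X L ∘ (L ◁ coev) ∘ runiti L = idm L.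

Definition rigid (C : monoidal_category) : Prop :=
  forall X : C, (exists L, dual_pair L X) /\ (exists L, dual_pair X L).

(* Functors are split into data and laws so that two functors with dependent
   structure maps can be compared through an equality of their data. *)

Record functor_data (C D : category) := FunctorData {
  fob :> C -> D;
  fmap : forall X Y : C, hom X Y -> hom (fob X) (fob Y)
}.
Arguments fmap {C D} F {X Y} f : rename.

Record is_functor (C D : category) (F : functor_data C D) : Prop := IsFunctor {
  fmap_id : forall X, fmap F (idm X) = idm (F X);
  fmap_comp : forall (X Y Z : C) (g : hom Y Z) (f : hom X Y),
    fmap F (g ∘ f) = fmap F g ∘ fmap F f
}.

Record functor (C D : category) := Functor {
  fdata :> functor_data C D;
  functorP : is_functor fdata
}.

Record lax_data (C D : monoidal_category) := LaxData {
  lax_fdata :> functor_data C D;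
  lax : forall X Y : C, hom (lax_fdata X ⊗ lax_fdata Y) (lax_fdata (X ⊗ Y));
  lax0 : hom 𝟙 (lax_fdata 𝟙)
}.
Arguments lax {C D} F X Y : rename.
Arguments lax0 {C D} F : rename.

Record is_lax_monoidal (C D : monoidal_category) (F : lax_data C D) : Prop :=
  IsLaxMonoidal {
  lax_functorP : is_functor F;
  lax_nat : forall (X X' Y Y' : C) (f : hom X X') (g : hom Y Y'),
    lax F X' Y' ∘ (fmap F f ⊗₁ fmap F g) = fmap F (f ⊗₁ g) ∘ lax F X Y;
  lax_assoc : forall X Y Z : C,
    lax F X (Y ⊗ Z) ∘ (F X ◁ lax F Y Z) ∘ assoc (F X) (F Y) (F Z) =
    fmap F (assoc X Y Z) ∘ lax F (X ⊗ Y) Z ∘ (lax F X Y ▷ F Z);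
  lax_lunit : forall X : C,
    fmap F (lunit X) ∘ lax F 𝟙 X ∘ (lax0 F ▷ F X) = lunit (F X);
  lax_runit : forall X : C,
    fmap F (runit X) ∘ lax F X 𝟙 ∘ (F X ◁ lax0 F) = runit (F X)
}.

Record strong_monoidal_functor (C D : monoidal_category) :=
  StrongMonoidalFunctor {
  strong_data :> lax_data C D;
  strong_laxP : is_lax_monoidal strong_data;
  oplax : forall X Y : C,
    hom (strong_data (X ⊗ Y)) (strong_data X ⊗ strong_data Y);
  oplax0 : hom (strong_data 𝟙) 𝟙;
  oplaxP : forall X Y, inverse_pair (lax strong_data X Y) (oplax X Y);
  oplax0P : inverse_pair (lax0 strong_data) oplax0
}.
Arguments oplax {C D} F X Y : rename.
Arguments oplax0 {C D} F : rename.

Record braided_monoidal_category := BraidedMonoidalCategory {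
  bmcat :> monoidal_category;
  braid : forall X Y : bmcat, hom (X ⊗ Y) (Y ⊗ X);
  braid_iso : forall X Y, is_iso (braid X Y);
  braid_nat : forall (X X' Y Y' : bmcat) (f : hom X X') (g : hom Y Y'),
    braid X' Y' ∘ (f ⊗₁ g) = (g ⊗₁ f) ∘ braid X Y;
  hexagon1 : forall X Y Z : bmcat,
    assoc Y Z X ∘ braid X (Y ⊗ Z) ∘ assoc X Y Z =
    (Y ◁ braid X Z) ∘ assoc Y X Z ∘ (braid X Y ▷ Z);
  hexagon2 : forall X Y Z : bmcat,
    associ Z X Y ∘ braid (X ⊗ Y) Z ∘ associ X Y Z =
    (braid X Z ▷ Y) ∘ associ X Z Y ∘ (X ◁ braid Y Z)
}.
Arguments braid {b} X Y.

Record braided_lax_monoidal_functor (C D : braided_monoidal_category) :=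
  BraidedLaxMonoidalFunctor {
  blax_data :> lax_data C D;
  blax_laxP : is_lax_monoidal blax_data;
  blax_braid : forall X Y : C,
    lax blax_data Y X ∘ braid (blax_data X) (blax_data Y) =
    fmap blax_data (braid X Y) ∘ lax blax_data X Y
}.

Record adjunction (C D : category) (G : functor_data C D)
    (R : functor_data D C) := Adjunction {
  aunit : forall A : C, hom A (R (G A));
  acounit : forall X : D, hom (G (R X)) X;
  aunit_nat : forall (A B : C) (f : hom A B),
    aunit B ∘ f = fmap R (fmap G f) ∘ aunit A;
  acounit_nat : forall (X Y : D) (f : hom X Y),
    acounit Y ∘ fmap G (fmap R f) = f ∘ acounit X;
  adj_triangle1 : forall A : C, acounit (G A) ∘ fmap G (aunit A) = idm (G A);
  adj_triangle2 : forall X : D, fmap R (acounit X) ∘ aunit (R X) = idm (R X)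
}.

Record is_half_braiding (C : monoidal_category) (X : C)
    (c : forall A : C, hom (X ⊗ A) (A ⊗ X)) : Prop := IsHalfBraiding {
  half_iso : forall A, is_iso (c A);
  half_nat : forall (A B : C) (f : hom A B),
    c B ∘ (X ◁ f) = (f ▷ X) ∘ c A;
  half_tens : forall A B : C,
    c (A ⊗ B) =
    associ A B X ∘ (A ◁ c B) ∘ assoc A X B ∘ (c A ▷ B) ∘ associ X A B;
  half_unit : c 𝟙 = luniti X ∘ runit X
}.

Section CoherenceLemmas.
Variable C : monoidal_category.
Implicit Types X Y Z W A B : C.

Lemma pre_comp (K : category) (X Y Z : K) (f : hom Y Z) (g : hom X Y) k :
  f ∘ g = k -> forall (W : K) (h : hom W X), f ∘ (g ∘ h) = k ∘ h.
Proof. by move=> <- W h; rewrite compA. Qed.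

Lemma epi_of_inv (K : category) (X Y Z : K) (u : hom X Y) u' (f g : hom Y Z) :
  inverse_pair u u' -> f ∘ u = g ∘ u -> f = g.
Proof.
by move=> [_ uK] e; rewrite -(comp_idr f) -(comp_idr g) -uK !compA e.
Qed.

Lemma mono_of_inv (K : category) (X Y Z : K) (u : hom Y Z) u' (f g : hom X Y) :
  inverse_pair u u' -> u ∘ f = u ∘ g -> f = g.
Proof.
by move=> [uK _] e; rewrite -(comp_idl f) -(comp_idl g) -uK -!compA e.
Qed.

Lemma inv_sym (K : category) (X Y : K) (u : hom X Y) u' :
  inverse_pair u u' -> inverse_pair u' u.
Proof. by case. Qed.

Lemma invK (K : category) (X Y : K) (u : hom X Y) u' :
  inverse_pair u u' -> forall (W : K) (h : hom W X), u' ∘ (u ∘ h) = h.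
Proof. by case=> uK _ W h; rewrite compA uK comp_idl. Qed.

Lemma inviK (K : category) (X Y : K) (u : hom X Y) u' :
  inverse_pair u u' -> forall (W : K) (h : hom W Y), u ∘ (u' ∘ h) = h.
Proof. by case=> _ uK W h; rewrite compA uK comp_idl. Qed.

Lemma assocK X Y Z : associ X Y Z ∘ assoc X Y Z = idm _.
Proof. by case: (assocP X Y Z). Qed.
Lemma associK X Y Z : assoc X Y Z ∘ associ X Y Z = idm _.
Proof. by case: (assocP X Y Z). Qed.
Lemma lunitK X : luniti X ∘ lunit X = idm _.
Proof. by case: (lunitP X). Qed.
Lemma lunitiK X : lunit X ∘ luniti X = idm _.
Proof. by case: (lunitP X). Qed.
Lemma runitK X : runiti X ∘ runit X = idm _.
Proof. by case: (runitP X). Qed.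
Lemma runitiK X : runit X ∘ runiti X = idm _.
Proof. by case: (runitP X). Qed.

Lemma lwhisk_comp X Y Y' Y'' (g : hom Y' Y'') (f : hom Y Y') :
  X ◁ (g ∘ f) = (X ◁ g) ∘ (X ◁ f).
Proof. by rewrite -tensm_comp comp_idl. Qed.

Lemma rwhisk_comp X Y Y' Y'' (g : hom Y' Y'') (f : hom Y Y') :
  (g ∘ f) ▷ X = (g ▷ X) ∘ (f ▷ X).
Proof. by rewrite -tensm_comp comp_idl. Qed.

Lemma whisk_exch X X' Y Y' (f : hom X X') (g : hom Y Y') :
  (X' ◁ g) ∘ (f ▷ Y) = (f ▷ Y') ∘ (X ◁ g).
Proof. by rewrite -!tensm_comp !comp_idl !comp_idr. Qed.

Lemma tensm_whisk X X' Y Y' (f : hom X X') (g : hom Y Y') :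
  f ⊗₁ g = (X' ◁ g) ∘ (f ▷ Y).
Proof. by rewrite -tensm_comp comp_idl comp_idr. Qed.

Lemma lwhisk_inv X Y Y' (f : hom Y Y') g :
  inverse_pair f g -> inverse_pair (X ◁ f) (X ◁ g).
Proof. by case=> gf fg; split; rewrite -lwhisk_comp ?gf ?fg tensm_id. Qed.

Lemma rwhisk_inv X Y Y' (f : hom Y Y') g :
  inverse_pair f g -> inverse_pair (f ▷ X) (g ▷ X).
Proof. by case=> gf fg; split; rewrite -rwhisk_comp ?gf ?fg tensm_id. Qed.

Lemma lwhisk_inj X Y (f g : hom X Y) : 𝟙 ◁ f = 𝟙 ◁ g -> f = g.
Proof.
move=> e; apply: (epi_of_inv (lunitP X)).
by rewrite -!lunit_nat e.
Qed.

Lemma rwhisk_inj X Y (f g : hom X Y) : f ▷ 𝟙 = g ▷ 𝟙 -> f = g.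
Proof.
move=> e; apply: (epi_of_inv (runitP X)).
by rewrite -!runit_nat e.
Qed.

Lemma assoc_natl X X' Y Z (f : hom X X') :
  assoc X' Y Z ∘ (f ▷ Y ▷ Z) = (f ▷ (Y ⊗ Z)) ∘ assoc X Y Z.
Proof. by rewrite assoc_nat tensm_id. Qed.

Lemma assoc_natr X Y Z Z' (f : hom Z Z') :
  assoc X Y Z' ∘ ((X ⊗ Y) ◁ f) = (X ◁ Y ◁ f) ∘ assoc X Y Z.
Proof. by rewrite -tensm_id assoc_nat. Qed.

Lemma associ_nat X X' Y Y' Z Z' (f : hom X X') (g : hom Y Y') (h : hom Z Z') :
  associ X' Y' Z' ∘ (f ⊗₁ (g ⊗₁ h)) = ((f ⊗₁ g) ⊗₁ h) ∘ associ X Y Z.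
Proof.
apply: (epi_of_inv (assocP X Y Z)); rewrite -!compA -assoc_nat assocK comp_idr.
by rewrite compA assocK comp_idl.
Qed.

Lemma luniti_nat X Y (f : hom X Y) : luniti Y ∘ f = (𝟙 ◁ f) ∘ luniti X.
Proof.
apply: (mono_of_inv (lunitP Y)).
by rewrite (inviK (lunitP Y)) compA lunit_nat -compA lunitiK comp_idr.
Qed.

Lemma runiti_nat X Y (f : hom X Y) : runiti Y ∘ f = (f ▷ 𝟙) ∘ runiti X.
Proof.
apply: (mono_of_inv (runitP Y)).
by rewrite (inviK (runitP Y)) compA runit_nat -compA runitiK comp_idr.
Qed.

(* The two unit coherences that follow from triangle and pentagon. *)
Lemma lunit_tens X Y : lunit (X ⊗ Y) ∘ assoc 𝟙 X Y = lunit X ▷ Y.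
Proof.
apply: lwhisk_inj; rewrite lwhisk_comp.
apply: (epi_of_inv (assocP 𝟙 (𝟙 ⊗ X) Y)).
apply: (epi_of_inv (rwhisk_inv Y (assocP 𝟙 𝟙 X))).
rewrite -!compA (compA (𝟙 ◁ assoc _ _ _)) -pentagon compA triangle.
rewrite -assoc_natl.
by rewrite compA -assoc_nat -compA -rwhisk_comp triangle.
Qed.

Lemma runit_tens X Y : (X ◁ runit Y) ∘ assoc X Y 𝟙 = runit (X ⊗ Y).
Proof.
apply: rwhisk_inj; rewrite rwhisk_comp.
apply: (mono_of_inv (assocP X Y 𝟙)).
rewrite compA assoc_nat -triangle lwhisk_comp -!compA.
rewrite (compA (X ◁ assoc _ _ _)) -pentagon compA -assoc_natr -compA.
by rewrite triangle.
Qed.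

Lemma lunit_runit1 : lunit (𝟙 : C) = runit 𝟙.
Proof.
apply: rwhisk_inj; rewrite -lunit_tens -triangle.
congr (_ ∘ _); apply: (mono_of_inv (lunitP _)).
by rewrite lunit_nat.
Qed.

Lemma pentagon_tail W X Y Z V (h : hom V _) :
  (W ◁ assoc X Y Z) ∘ (assoc W (X ⊗ Y) Z ∘ ((assoc W X Y ▷ Z) ∘ h)) =
  assoc W X (Y ⊗ Z) ∘ (assoc (W ⊗ X) Y Z ∘ h).
Proof. by rewrite [RHS]compA pentagon -!compA. Qed.

Lemma lunit_tensi X Y : (lunit X ▷ Y) ∘ associ 𝟙 X Y = lunit (X ⊗ Y).
Proof. by rewrite -lunit_tens -compA associK comp_idr. Qed.

Lemma luniti_tens X Y : assoc 𝟙 X Y ∘ (luniti X ▷ Y) = luniti (X ⊗ Y).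
Proof.
apply: (mono_of_inv (lunitP _)).
by rewrite lunitiK compA lunit_tens -rwhisk_comp lunitiK tensm_id.
Qed.

Lemma runiti_tens X Y : associ X Y 𝟙 ∘ (X ◁ runiti Y) = runiti (X ⊗ Y).
Proof.
apply: (mono_of_inv (runitP _)).
rewrite runitiK -runit_tens -compA (inviK (assocP _ _ _)).
by rewrite -lwhisk_comp runitiK tensm_id.
Qed.

Lemma triangle_runiti X Y : assoc X 𝟙 Y ∘ (runiti X ▷ Y) = X ◁ luniti Y.
Proof.
apply: (mono_of_inv (lwhisk_inv X (lunitP Y))).
by rewrite compA triangle -rwhisk_comp -lwhisk_comp runitiK lunitiK !tensm_id.
Qed.

Lemma triangle_lunit X Y : (runit X ▷ Y) ∘ associ X 𝟙 Y = X ◁ lunit Y.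
Proof. by rewrite -triangle -compA associK comp_idr. Qed.

(* Extends a morphism of binary tensor products by Z on the right, with all
   objects bracketed to the right. *)
Definition ext X Y X' Y' (f : hom (X ⊗ Y) (X' ⊗ Y')) Z :
  hom (X ⊗ (Y ⊗ Z)) (X' ⊗ (Y' ⊗ Z)) :=
  locked (assoc X' Y' Z ∘ (f ▷ Z) ∘ associ X Y Z).

Lemma extE X Y X' Y' (f : hom (X ⊗ Y) (X' ⊗ Y')) Z :
  ext f Z = assoc X' Y' Z ∘ ((f ▷ Z) ∘ associ X Y Z).
Proof. by rewrite /ext -lock compA. Qed.

Lemma ext_nat X Y X' Y' (f : hom (X ⊗ Y) (X' ⊗ Y')) Z Z' (g : hom Z Z') :
  (X' ◁ Y' ◁ g) ∘ ext f Z = ext f Z' ∘ (X ◁ Y ◁ g).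
Proof.
rewrite !extE (pre_comp (esym (assoc_natr _ _ _))) -!compA (pre_comp (whisk_exch _ _)) -!compA.
by rewrite associ_nat tensm_id.
Qed.

Lemma ext_comp X Y X' Y' X'' Y''
    (g : hom (X' ⊗ Y') (X'' ⊗ Y'')) (f : hom (X ⊗ Y) (X' ⊗ Y')) Z :
  ext (g ∘ f) Z = ext g Z ∘ ext f Z.
Proof.
rewrite !extE rwhisk_comp -!compA; do 2 congr (_ ∘ _).
by rewrite (compA (associ _ _ _)) assocK comp_idl.
Qed.

Lemma ext_natl X A B Y (c : hom (X ⊗ A) (A ⊗ X)) (d : hom (X ⊗ B) (B ⊗ X))
    (f : hom A B) :
  d ∘ (X ◁ f) = (f ▷ X) ∘ c ->
  ext d Y ∘ (X ◁ (f ▷ Y)) = (f ▷ (X ⊗ Y)) ∘ ext c Y.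
Proof.
move=> e; rewrite !extE -!compA associ_nat (pre_comp (esym (rwhisk_comp _ _ _))).
by rewrite e rwhisk_comp -compA (pre_comp (assoc_natl _ _ _)) -compA.
Qed.

Lemma ext_assoc X Y X' Y' (f : hom (X ⊗ Y) (X' ⊗ Y')) W Z :
  (X' ◁ assoc Y' W Z) ∘ ext (ext f W) Z = ext f (W ⊗ Z) ∘ (X ◁ assoc Y W Z).
Proof.
apply: (epi_of_inv (assocP X (Y ⊗ W) Z)).
apply: (epi_of_inv (rwhisk_inv Z (assocP X Y W))).
rewrite -[RHS]compA -[RHS]compA [in RHS](compA (X ◁ _)) -pentagon.
rewrite !extE -!compA (pre_comp (assocK X Y _)) comp_idl.
rewrite !rwhisk_comp -!compA (pre_comp (assocK _ _ _)) comp_idl.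
rewrite -(rwhisk_comp Z) assocK tensm_id comp_idr.
by rewrite pentagon_tail assoc_natl.
Qed.

Lemma ext_lwhisk X Y W Y' W' (g : hom (Y ⊗ W) (Y' ⊗ W')) Z :
  (X ◁ assoc Y' W' Z) ∘ ext ((X ◁ g) ∘ assoc X Y W) Z =
  (X ◁ ext g Z) ∘ assoc X Y (W ⊗ Z).
Proof.
apply: (epi_of_inv (assocP (X ⊗ Y) W Z)).
rewrite !extE -!compA assocK comp_idr pentagon !lwhisk_comp rwhisk_comp -!compA.
rewrite (pre_comp (assoc_nat _ _ _)) -!compA.
by rewrite (invK (lwhisk_inv X (assocP Y W Z))).
Qed.

Lemma ext_lwhiski A X B B' X' (g : hom (X ⊗ B) (B' ⊗ X')) Y :
  assoc A B' (X' ⊗ Y) ∘ ext (associ A B' X' ∘ (A ◁ g)) Y =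
  (A ◁ ext g Y) ∘ (A ◁ assoc X B Y).
Proof.
apply: (epi_of_inv (assocP A (X ⊗ B) Y)).
rewrite !extE -!compA assocK comp_idr rwhisk_comp !lwhisk_comp -!compA.
rewrite (invK (lwhisk_inv A (assocP X B Y))) -pentagon_tail.
rewrite (inviK (rwhisk_inv Y (assocP A B' X'))).
by rewrite assoc_nat.
Qed.

Lemma is_iso_comp X Y Z (g : hom Y Z) (f : hom X Y) :
  is_iso g -> is_iso f -> is_iso (g ∘ f).
Proof.
case=> g' [g'g gg'] [f' [f'f ff']]; exists (f' ∘ g'); split.
  by rewrite -compA (pre_comp g'g) comp_idl.
by rewrite -compA (pre_comp ff') comp_idl.
Qed.

Lemma is_iso_of_pair X Y (f : hom X Y) g : inverse_pair f g -> is_iso f.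
Proof. by exists g. Qed.

Lemma is_iso_lwhisk X Y Y' (f : hom Y Y') : is_iso f -> is_iso (X ◁ f).
Proof. by case=> g fg; exists (X ◁ g); apply: lwhisk_inv. Qed.

Lemma is_iso_rwhisk X Y Y' (f : hom Y Y') : is_iso f -> is_iso (f ▷ X).
Proof. by case=> g fg; exists (g ▷ X); apply: rwhisk_inv. Qed.

Lemma half_tens_ext X (c : forall A, hom (X ⊗ A) (A ⊗ X)) :
  is_half_braiding c -> forall A B,
  c (A ⊗ B) = associ A B X ∘ ((A ◁ c B) ∘ ext (c A) B).
Proof. by move=> hc A B; rewrite (half_tens hc) !extE -!compA. Qed.

Lemma half_tens_ext' X (c : forall A, hom (X ⊗ A) (A ⊗ X)) :
  is_half_braiding c -> forall A B,
  (A ◁ c B) ∘ ext (c A) B = assoc A B X ∘ c (A ⊗ B).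
Proof. by move=> hc A B; rewrite half_tens_ext // (inviK (assocP A B X)). Qed.

Lemma ext_pre X Y X' Y' (f : hom (X ⊗ Y) (X' ⊗ Y')) Z :
  ext f Z ∘ assoc X Y Z = assoc X' Y' Z ∘ (f ▷ Z).
Proof. by rewrite extE -!compA assocK comp_idr. Qed.

End CoherenceLemmas.

Record center_ob (C : monoidal_category) := CenterOb {
  cob :> C;
  half : forall A : C, hom (cob ⊗ A) (A ⊗ cob);
  halfP : is_half_braiding half
}.
Arguments half {C} X A : rename.

Definition is_center_mor (C : monoidal_category) (X Y : center_ob C)
    (f : hom (cob X) (cob Y)) : Prop :=
  forall A : C, half Y A ∘ (f ▷ A) = (A ◁ f) ∘ half X A.

Record center_hom (C : monoidal_category) (X Y : center_ob C) := CenterHom {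
  chom :> hom (cob X) (cob Y);
  chomP : is_center_mor chom
}.

Section Center.
Variable C : monoidal_category.
Implicit Types X Y Z W : center_ob C.

Lemma center_hom_eq X Y (f g : center_hom X Y) : chom f = chom g -> f = g.
Proof.
case: f g => [f fP] [g gP] /= e; case: g / e gP => gP.
by rewrite (proof_irrelevance _ fP gP).
Qed.

Lemma center_id_subproof X : is_center_mor (idm (cob X) : hom (cob X) (cob X)).
Proof. by move=> A; rewrite !tensm_id comp_idl comp_idr. Qed.

Lemma center_comp_subproof X Y Z (g : center_hom Y Z) (f : center_hom X Y) :
  is_center_mor (chom g ∘ chom f).
Proof.
move=> A; rewrite rwhisk_comp lwhisk_comp compA chomP -compA chomP.
by rewrite compA.
Qed.

Definition center_cat : category.
Proof.
refine (@Category (center_ob C) (@center_hom C)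
  (fun X => CenterHom (center_id_subproof X))
  (fun X Y Z g f => CenterHom (center_comp_subproof g f)) _ _ _).
- by move=> X Y f; apply: center_hom_eq; apply: comp_idl.
- by move=> X Y f; apply: center_hom_eq; apply: comp_idr.
- by move=> W X Y Z h g f; apply: center_hom_eq; apply: compA.
Defined.

Definition tens_half X Y (A : C) : hom (X ⊗ Y ⊗ A) (A ⊗ (X ⊗ Y)) :=
  assoc A X Y ∘ (half X A ▷ Y) ∘ associ X A Y ∘ (X ◁ half Y A) ∘ assoc X Y A.

Definition unit_half (A : C) : hom (𝟙 ⊗ A) (A ⊗ 𝟙) := runiti A ∘ lunit A.

Lemma tens_half_ext X Y A :
  tens_half X Y A = ext (half X A) Y ∘ ((X ◁ half Y A) ∘ assoc X Y A).
Proof. by rewrite /tens_half !extE -!compA. Qed.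

Lemma ext_tens_half X Y A B :
  (A ◁ assoc X Y B) ∘ ext (tens_half X Y A) B =
  ext (half X A) (Y ⊗ B) ∘ ((X ◁ ext (half Y A) B) ∘ assoc X Y (A ⊗ B)).
Proof.
by rewrite tens_half_ext ext_comp compA ext_assoc -compA ext_lwhisk.
Qed.

Lemma unit_half_subproof : is_half_braiding unit_half.
Proof.
split.
- move=> A; apply: is_iso_comp.
    exact: is_iso_of_pair (inv_sym (runitP A)).
  exact: is_iso_of_pair (lunitP A).
- by move=> A B f; rewrite /unit_half -compA lunit_nat compA runiti_nat -compA.
- move=> A B; rewrite /unit_half lwhisk_comp rwhisk_comp -!compA.
  rewrite (pre_comp (triangle_runiti _ _)) (inviK (lwhisk_inv A (lunitP B))).
  by rewrite lunit_tensi compA runiti_tens.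
- by rewrite /unit_half lunit_runit1 runitK -lunit_runit1 lunitK.
Qed.

Lemma tens_half_subproof X Y : is_half_braiding (tens_half X Y).
Proof.
split.
- move=> A; rewrite tens_half_ext extE; repeat apply: is_iso_comp.
  + exact: is_iso_of_pair (assocP _ _ _).
  + exact/is_iso_rwhisk/(half_iso (halfP X)).
  + exact: is_iso_of_pair (inv_sym (assocP _ _ _)).
  + exact/is_iso_lwhisk/(half_iso (halfP Y)).
  + exact: is_iso_of_pair (assocP _ _ _).
- move=> A B f; rewrite !tens_half_ext -!compA assoc_natr.
  rewrite (pre_comp (esym (lwhisk_comp X _ _))) (half_nat (halfP Y)).
  rewrite lwhisk_comp -!compA (pre_comp (ext_natl Y (half_nat (halfP X) f))).
  by rewrite -compA.
- move=> A B; transitivity (associ A B (X ⊗ Y) ∘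
      ((A ◁ tens_half X Y B) ∘ ext (tens_half X Y A) B)); last first.
    by rewrite extE !compA.
  apply: (mono_of_inv (assocP A B _)); rewrite (inviK (assocP A B _)).
  rewrite (tens_half_ext X Y (A ⊗ B)) (tens_half_ext X Y B).
  rewrite (half_tens_ext (halfP X)) (half_tens_ext (halfP Y)).
  rewrite (compA (associ A B X)) ext_comp -!compA (pre_comp (ext_lwhiski _ _ _)).
  rewrite -!compA (pre_comp (ext_assoc _ _ _)) !lwhisk_comp -!compA.
  rewrite (inviK (lwhisk_inv X (assocP A B Y))).
  rewrite ext_tens_half.
  by rewrite (pre_comp (ext_nat _ _)) -!compA.
- rewrite tens_half_ext (half_unit (halfP X)) (half_unit (halfP Y)).
  rewrite !extE rwhisk_comp lwhisk_comp -!compA (pre_comp (triangle_lunit _ _)).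
  rewrite (inviK (lwhisk_inv X (lunitP Y))) runit_tens.
  by rewrite (pre_comp (luniti_tens _ _)).
Qed.

Definition center_tens X Y : center_ob C := CenterOb (tens_half_subproof X Y).
Definition center_unit : center_ob C := CenterOb unit_half_subproof.

Lemma center_tensm_subproof X X' Y Y' (f : center_hom X X')
    (g : center_hom Y Y') :
  @is_center_mor C (center_tens X Y) (center_tens X' Y') (chom f ⊗₁ chom g).
Proof.
move=> A /=; rewrite /tens_half -!compA assoc_nat.
rewrite (compA (X' ◁ _)) -tensm_comp comp_idl chomP.
rewrite -(comp_idr (chom f)) tensm_comp -!compA comp_idr.
rewrite (pre_comp (associ_nat _ _ _)) -!compA (compA (half X' A ▷ Y')).
rewrite -tensm_comp comp_idl chomP -(comp_idr (chom g)) tensm_comp -!compA.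
by rewrite (pre_comp (assoc_nat _ _ _)) comp_idr -!compA.
Qed.

Lemma center_assoc_subproof X Y Z :
  @is_center_mor C (center_tens (center_tens X Y) Z)
    (center_tens X (center_tens Y Z)) (assoc (cob X) (cob Y) (cob Z)).
Proof.
move=> A /=; rewrite (tens_half_ext (center_tens X Y)) /=.
rewrite (pre_comp (ext_tens_half _ _ _ _)) tens_half_ext /= tens_half_ext.
rewrite !lwhisk_comp -!compA (pre_comp (assoc_natr _ _ _)) -!compA.
by rewrite (compA (X ◁ assoc _ _ _)) -pentagon.
Qed.

Lemma center_lunit_subproof X :
  @is_center_mor C (center_tens center_unit X) X (lunit (cob X)).
Proof.
move=> A /=; rewrite tens_half_ext /= /unit_half extE rwhisk_comp -!compA.
rewrite (pre_comp (triangle_runiti _ _)) (inviK (lwhisk_inv A (lunitP X))).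
rewrite (pre_comp (lunit_tensi _ _)) (pre_comp (lunit_nat _)) -compA.
by rewrite lunit_tens.
Qed.

Lemma center_runit_subproof X :
  @is_center_mor C (center_tens X center_unit) X (runit (cob X)).
Proof.
move=> A /=; rewrite tens_half_ext /= /unit_half extE lwhisk_comp -!compA.
rewrite (pre_comp (runit_tens _ _)) (pre_comp (runit_nat _)).
rewrite -compA (pre_comp (runiti_tens _ _)) (inviK (runitP _)).
by rewrite triangle.
Qed.

Lemma center_inv_subproof X Y (f : hom (cob X) (cob Y)) g :
  inverse_pair f g -> is_center_mor f -> is_center_mor g.
Proof.
move=> fg fP A; apply: (epi_of_inv (rwhisk_inv A fg)).
apply: (mono_of_inv (lwhisk_inv A fg)).
rewrite -!compA (inviK (lwhisk_inv A fg)) compA -fP -compA.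
by rewrite -rwhisk_comp (proj1 fg) tensm_id comp_idr.
Qed.

Definition center_associ_subproof X Y Z :
  @is_center_mor C (center_tens X (center_tens Y Z))
    (center_tens (center_tens X Y) Z) (associ (cob X) (cob Y) (cob Z)) :=
  @center_inv_subproof (center_tens (center_tens X Y) Z)
    (center_tens X (center_tens Y Z)) _ _
    (assocP _ _ _) (center_assoc_subproof X Y Z).

Definition center_luniti_subproof X :
  @is_center_mor C X (center_tens center_unit X) (luniti (cob X)) :=
  @center_inv_subproof (center_tens center_unit X) X _ _
    (lunitP _) (center_lunit_subproof X).

Definition center_runiti_subproof X :
  @is_center_mor C X (center_tens X center_unit) (runiti (cob X)) :=
  @center_inv_subproof (center_tens X center_unit) X _ _
    (runitP _) (center_runit_subproof X).

Lemma center_braid_subproof X Y :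
  @is_center_mor C (center_tens X Y) (center_tens Y X) (half X (cob Y)).
Proof.
move=> A /=; rewrite !tens_half_ext -!compA -ext_pre.
rewrite (pre_comp (half_tens_ext' (halfP X) _ _)) -!compA.
rewrite (pre_comp (ext_pre _ _)) -compA (pre_comp (esym (half_nat (halfP X) _))).
by rewrite (pre_comp (half_tens_ext' (halfP X) _ _)) -!compA.
Qed.

Definition center_mon : monoidal_category.
Proof.
refine (@MonoidalCategory center_cat center_unit center_tens
  (fun X X' Y Y' f g => CenterHom (center_tensm_subproof f g))
  (fun X Y Z => CenterHom (center_assoc_subproof X Y Z))
  (fun X Y Z => CenterHom (center_associ_subproof X Y Z))
  (fun X => CenterHom (center_lunit_subproof X))
  (fun X => CenterHom (center_luniti_subproof X))
  (fun X => CenterHom (center_runit_subproof X))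
  (fun X => CenterHom (center_runiti_subproof X))
  _ _ _ _ _ _ _ _ _ _); intros; try split; apply: center_hom_eq => /=.
- exact: tensm_id.
- exact: tensm_comp.
- exact: assocK.
- exact: associK.
- exact: lunitK.
- exact: lunitiK.
- exact: runitK.
- exact: runitiK.
- exact: assoc_nat.
- exact: lunit_nat.
- exact: runit_nat.
- exact: triangle.
- exact: pentagon.
Defined.

Definition center : braided_monoidal_category.
Proof.
refine (@BraidedMonoidalCategory center_mon
  (fun X Y => CenterHom (center_braid_subproof X Y)) _ _ _ _).
- move=> X Y; have [g fg] := half_iso (halfP X) (cob Y).
  exists (CenterHom (@center_inv_subproof (center_tens X Y) (center_tens Y X)
    _ _ fg (center_braid_subproof X Y))).
  by split; apply: center_hom_eq; case: fg.
- move=> X X' Y Y' f g; apply: center_hom_eq => /=.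
  rewrite tensm_whisk compA (half_nat (halfP X')) -compA chomP compA.
  by rewrite -tensm_comp comp_idl comp_idr.
- move=> X Y Z; apply: center_hom_eq => /=.
  rewrite (half_tens (halfP X)) -!compA assocK comp_idr.
  by rewrite (inviK (assocP _ _ _)).
- move=> X Y Z; apply: center_hom_eq => /=.
  rewrite /tens_half -!compA associK comp_idr.
  by rewrite (invK (assocP _ _ _)).
Defined.

End Center.

Section RightAdjoint.
Variables (C D : monoidal_category) (G : strong_monoidal_functor C D).
Variables (R : functor D C) (adj : adjunction G R).

(* The lax structure for which unit and counit are monoidal. *)
Definition radj_lax (X Y : D) : hom (R X ⊗ R Y) (R (X ⊗ Y)) :=
  fmap R (acounit adj X ⊗₁ acounit adj Y) ∘ fmap R (oplax G (R X) (R Y))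
    ∘ aunit adj (R X ⊗ R Y).

Definition radj_lax0 : hom 𝟙 (R 𝟙) := fmap R (oplax0 G) ∘ aunit adj 𝟙.

Definition lproj (A : C) (X : D) : hom (A ⊗ R X) (R (G A ⊗ X)) :=
  radj_lax (G A) X ∘ (aunit adj A ▷ R X).

Definition rproj (X : D) (A : C) : hom (R X ⊗ A) (R (X ⊗ G A)) :=
  radj_lax X (G A) ∘ (R X ◁ aunit adj A).

Section Induced.
(* To be instantiated with the inverses of the morphisms lproj A X. *)
Variable lproji : forall (A : C) (X : D), hom (R (G A ⊗ X)) (A ⊗ R X).

Definition radj_half (Z : center D) (A : C) :
    hom (R (cob Z) ⊗ A) (A ⊗ R (cob Z)) :=
  lproji A (cob Z) ∘ fmap R (half Z (G A)) ∘ rproj (cob Z) A.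

Variable radj_halfP :
  forall Z : center D, is_half_braiding (radj_half Z).

Definition center_radj_ob (Z : center D) : center C := CenterOb (radj_halfP Z).

Definition center_radj_fmapP : Prop :=
  forall (Z W : center D) (f : hom Z W),
  @is_center_mor C (center_radj_ob Z) (center_radj_ob W) (fmap R (chom f)).

Definition center_radj_laxP : Prop :=
  forall Z W : center D,
  @is_center_mor C (center_radj_ob Z ⊗ center_radj_ob W)
    (center_radj_ob (Z ⊗ W)) (radj_lax (cob Z) (cob W)).

Definition center_radj_lax0P : Prop :=
  @is_center_mor C (𝟙 : center C) (center_radj_ob 𝟙) radj_lax0.

Definition center_radj_data (hm : center_radj_fmapP) (h2 : center_radj_laxP)
    (h0 : center_radj_lax0P) : lax_data (center D) (center C) :=
  @LaxData (center D) (center C)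
    (@FunctorData (center D) (center C) center_radj_ob
      (fun Z W f => CenterHom (hm Z W f)))
    (fun Z W => CenterHom (h2 Z W))
    (CenterHom h0).

End Induced.

(* The existence of the inverses of lproj, and the fact that the formulas give
   half-braidings and morphisms of the center, are part of the assertion. *)
Definition induced_by_radj
    (ZR : braided_lax_monoidal_functor (center D) (center C)) : Prop :=
  exists (lproji : forall (A : C) (X : D), hom (R (G A ⊗ X)) (A ⊗ R X))
    (radj_halfP : forall X : center D, is_half_braiding (radj_half lproji X))
    (hm : center_radj_fmapP radj_halfP) (h2 : center_radj_laxP radj_halfP)
    (h0 : center_radj_lax0P radj_halfP),
    (forall A X, inverse_pair (lproj A X) (lproji A X)) /\
    blax_data ZR = center_radj_data hm h2 h0.

End RightAdjoint.

(* Main.v *)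
(* A morphism f into RX is determined by its transpose counit ∘ G f, and the
   transpose of lproj_{A,X} is (GA ◁ counit_X) ∘ oplax_{A,RX}.  Composition with
   lproj_{A,X} corresponds, under the adjunction and the dualities L ⊣ A and
   GL ⊣ GA, to Hom(L ⊗ B, RX) ≅ Hom(GL ⊗ GB, X), hence lproj is invertible; rproj
   is lproj for the reversed tensor products.  The half-braiding c^R is then
   characterized by
     (GA ◁ counit_X) ∘ oplax_{A,RX} ∘ G(c^R_A) =
       c_{GA} ∘ (counit_X ▷ GA) ∘ oplax_{RX,A},
   and every identity to be proved follows by transposing it. *)
From Corelib Require Import ssreflect ssrfun.
From Stdlib Require Import IndefiniteDescription.
Require Import Defs.
Set Implicit Arguments.
Unset Strict Implicit.
Unset Printing Implicit Defensive.
Local Open Scope cat_scope.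

(** * Composition and inverses in plain categories *)

Lemma pre_comp3 (K : category) (V X Y Z : K) (f : hom Y Z) (g : hom X Y)
    (h : hom V X) k :
  f ∘ (g ∘ h) = k -> forall (W : K) (t : hom W V), f ∘ (g ∘ (h ∘ t)) = k ∘ t.
Proof. by move=> <- W t; rewrite !compA. Qed.

Lemma inverse_pair_comp (K : category) (X Y Z : K) (g : hom Y Z) g'
    (f : hom X Y) f' :
  inverse_pair g g' -> inverse_pair f f' -> inverse_pair (g ∘ f) (f' ∘ g').
Proof.
move=> gg' ff'; split.
  by rewrite -compA (invK gg'); case: ff'.
by rewrite -compA (inviK ff'); case: gg'.
Qed.

Lemma inverse_unique (K : category) (X Y : K) (f : hom X Y) g g' :
  inverse_pair f g -> inverse_pair f g' -> g = g'.
Proof.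
by move=> fg fg'; apply: (mono_of_inv fg); rewrite (proj2 fg) (proj2 fg').
Qed.

Lemma fmap_is_iso (C D : category) (F : functor C D) (X Y : C) (f : hom X Y) :
  is_iso f -> is_iso (fmap F f).
Proof.
case=> g [gf fg]; exists (fmap F g).
by split; rewrite -(fmap_comp (functorP F)) ?gf ?fg (fmap_id (functorP F)).
Qed.

(** * Mates under a duality *)

Section Mates.
Variables (C : monoidal_category) (L A : C).
Variables (ev : hom (L ⊗ A) 𝟙) (coev : hom 𝟙 (A ⊗ L)).

(** [mate] and [comate] are the two directions of Hom(B, A ⊗ X) ≅ Hom(L ⊗ B, X); that they are
    mutually inverse rests on the zigzag identities. *)
Definition mate B X (h : hom B (A ⊗ X)) : hom (L ⊗ B) X :=
  lunit X ∘ ((ev ▷ X) ∘ (associ L A X ∘ (L ◁ h))).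

Definition comate B X (k : hom (L ⊗ B) X) : hom B (A ⊗ X) :=
  (A ◁ k) ∘ (assoc A L B ∘ ((coev ▷ B) ∘ luniti B)).

(** Interchange moves [h] out from between [coev] and [ev], which then meet in the zigzag at [A]. *)
Lemma mateK B X (h : hom B (A ⊗ X)) :
  runit A ∘ (A ◁ ev) ∘ assoc A L A ∘ (coev ▷ A) ∘ luniti A = idm A ->
  comate (mate h) = h.
Proof.
move=> zigzag; rewrite /comate /mate !lwhisk_comp -!compA.
rewrite (pre_comp (esym (assoc_natr A L h))) -!compA.
rewrite (pre_comp (whisk_exch coev h)) -!compA.
rewrite -luniti_nat -luniti_tens -!compA.
rewrite (pre_comp (esym (assoc_natl _ _ coev))) -!compA -pentagon_tail.
rewrite (invK (lwhisk_inv A (assocP L A X))).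
rewrite (pre_comp (esym (assoc_nat (idm A) ev (idm X)))) -compA.
rewrite (pre_comp (triangle _ _)) !compA -!rwhisk_comp.
by rewrite zigzag tensm_id comp_idl.
Qed.

(** Here [k] is moved past [ev], and what precedes it is the zigzag at [L]. *)
Lemma comateK B X (k : hom (L ⊗ B) X) :
  lunit L ∘ (ev ▷ L) ∘ associ L A L ∘ (L ◁ coev) ∘ runiti L = idm L ->
  mate (comate k) = k.
Proof.
move=> zigzag; rewrite /comate /mate !lwhisk_comp.
rewrite (pre_comp (associ_nat _ _ _)) tensm_id -!compA.
rewrite (pre_comp (esym (whisk_exch ev k))) -!compA (pre_comp (lunit_nat k)).
rewrite -compA -[RHS]comp_idr; congr (_ ∘ _).
(* The pentagon, solved so that [coev] and [ev] become whiskered by [B] on the right. *)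
have pentagoni : associ L A (L ⊗ B) ∘ (L ◁ assoc A L B) =
    assoc (L ⊗ A) L B ∘ ((associ L A L ▷ B) ∘ associ L (A ⊗ L) B).
  apply: (mono_of_inv (assocP L A (L ⊗ B))).
  rewrite (inviK (assocP _ _ _)) -pentagon_tail.
  by rewrite (inviK (rwhisk_inv B (assocP L A L))) associK comp_idr.
rewrite (pre_comp pentagoni) -!compA (pre_comp (associ_nat _ _ _)) -!compA.
have -> : associ L 𝟙 B ∘ (L ◁ luniti B) = runiti L ▷ B.
  by rewrite -triangle_runiti (invK (assocP _ _ _)).
rewrite (pre_comp (esym (assoc_natl _ _ _))) -!compA (pre_comp (lunit_tens _ _)).
by rewrite -!rwhisk_comp !compA zigzag tensm_id.
Qed.

End Mates.

(** * The oplax structure of a strong monoidal functor and the images of dualities *)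

Section StrongMonoidal.
Variables (C D : monoidal_category) (G : strong_monoidal_functor C D).

Lemma strong_id X : fmap G (idm X) = idm (G X).
Proof. exact: fmap_id (lax_functorP (strong_laxP G)) X. Qed.

Lemma strong_comp (X Y Z : C) (g : hom Y Z) (f : hom X Y) :
  fmap G (g ∘ f) = fmap G g ∘ fmap G f.
Proof. exact: fmap_comp (lax_functorP (strong_laxP G)) _ _ _ g f. Qed.

Lemma oplax_nat (X X' Y Y' : C) (f : hom X X') (g : hom Y Y') :
  oplax G X' Y' ∘ fmap G (f ⊗₁ g) = (fmap G f ⊗₁ fmap G g) ∘ oplax G X Y.
Proof.
apply: (epi_of_inv (oplaxP G X Y)).
rewrite -!compA -(lax_nat (strong_laxP G)) (invK (oplaxP G X' Y')).
by rewrite (proj1 (oplaxP G X Y)) comp_idr.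
Qed.

Lemma oplax_natl (X Y Y' : C) (g : hom Y Y') :
  oplax G X Y' ∘ fmap G (X ◁ g) = (G X ◁ fmap G g) ∘ oplax G X Y.
Proof. by rewrite oplax_nat strong_id. Qed.

Lemma oplax_natr (X X' Y : C) (f : hom X X') :
  oplax G X' Y ∘ fmap G (f ▷ Y) = (fmap G f ▷ G Y) ∘ oplax G X Y.
Proof. by rewrite oplax_nat strong_id. Qed.

Lemma oplax_assoc (X Y Z : C) :
  (G X ◁ oplax G Y Z) ∘ (oplax G X (Y ⊗ Z) ∘ fmap G (assoc X Y Z)) =
  assoc (G X) (G Y) (G Z) ∘ ((oplax G X Y ▷ G Z) ∘ oplax G (X ⊗ Y) Z).
Proof.
apply: (epi_of_inv (oplaxP G (X ⊗ Y) Z)).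
apply: (epi_of_inv (rwhisk_inv (G Z) (oplaxP G X Y))).
rewrite -!compA (pre_comp (proj1 (oplaxP G (X ⊗ Y) Z))) comp_idl.
rewrite (proj1 (rwhisk_inv (G Z) (oplaxP G X Y))) comp_idr.
rewrite (compA (fmap G _)) -(lax_assoc (strong_laxP G)) -!compA.
rewrite (invK (oplaxP G X (Y ⊗ Z))).
by rewrite (invK (lwhisk_inv (G X) (oplaxP G Y Z))).
Qed.

Lemma oplax_associ (X Y Z : C) :
  (oplax G X Y ▷ G Z) ∘ (oplax G (X ⊗ Y) Z ∘ fmap G (associ X Y Z)) =
  associ (G X) (G Y) (G Z) ∘ ((G X ◁ oplax G Y Z) ∘ oplax G X (Y ⊗ Z)).
Proof.
apply: (mono_of_inv (assocP (G X) (G Y) (G Z))).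
rewrite (inviK (assocP _ _ _)) !compA -(compA (assoc _ _ _)) -oplax_assoc.
by rewrite -!compA -strong_comp associK strong_id comp_idr.
Qed.

Lemma oplax_lunit (X : C) :
  lunit (G X) ∘ ((oplax0 G ▷ G X) ∘ oplax G 𝟙 X) = fmap G (lunit X).
Proof.
rewrite -(lax_lunit (strong_laxP G)) -!compA.
rewrite (inviK (rwhisk_inv (G X) (oplax0P G))).
by rewrite (proj2 (oplaxP G 𝟙 X)) comp_idr.
Qed.

Lemma oplax_runit (X : C) :
  runit (G X) ∘ ((G X ◁ oplax0 G) ∘ oplax G X 𝟙) = fmap G (runit X).
Proof.
rewrite -(lax_runit (strong_laxP G)) -!compA.
rewrite (inviK (lwhisk_inv (G X) (oplax0P G))).
by rewrite (proj2 (oplaxP G X 𝟙)) comp_idr.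
Qed.

Lemma oplax_luniti (X : C) :
  oplax G 𝟙 X ∘ fmap G (luniti X) = (lax0 G ▷ G X) ∘ luniti (G X).
Proof.
apply: (mono_of_inv (rwhisk_inv (G X) (inv_sym (oplax0P G)))).
rewrite (invK (rwhisk_inv (G X) (oplax0P G))).
apply: (mono_of_inv (lunitP (G X))).
rewrite lunitiK (compA (oplax0 G ▷ _)) (compA (lunit _)) oplax_lunit.
by rewrite -strong_comp lunitiK strong_id.
Qed.

(** Strong monoidal functors preserve duals: with [fmap G ev] and [fmap G coev] corrected by the
    structure maps, the zigzag at [G A] is the image of the one at [A]. *)
Lemma strong_zigzag (L A : C) (ev : hom (L ⊗ A) 𝟙) (coev : hom 𝟙 (A ⊗ L)) :
  runit A ∘ (A ◁ ev) ∘ assoc A L A ∘ (coev ▷ A) ∘ luniti A = idm A ->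
  runit (G A) ∘ (G A ◁ (oplax0 G ∘ (fmap G ev ∘ lax G L A)))
    ∘ assoc (G A) (G L) (G A)
    ∘ ((oplax G A L ∘ (fmap G coev ∘ lax0 G)) ▷ G A) ∘ luniti (G A) =
  idm (G A).
Proof.
move=> /(congr1 (fmap G)); rewrite !strong_comp strong_id => zigzag.
rewrite -[RHS]zigzag -oplax_runit !lwhisk_comp !rwhisk_comp -!compA.
rewrite -oplax_luniti (pre_comp (oplax_natl _ _)) -!compA.
(* Up to naturality, only the associativity of [oplax] remains. *)
do 3 congr (_ ∘ _).
apply: (mono_of_inv (lwhisk_inv (G A) (inv_sym (oplaxP G L A)))).
rewrite (invK (lwhisk_inv (G A) (oplaxP G L A))).
rewrite !compA -(compA (_ ◁ _)) oplax_assoc -!compA.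
by rewrite (pre_comp (oplax_natr _ _)) -!compA.
Qed.

End StrongMonoidal.

(** * Transposition along the adjunction and invertibility of [lproj] *)

Section Transposition.
Variables (C D : monoidal_category) (G : strong_monoidal_functor C D).
Variables (R : functor D C) (adj : adjunction G R).
Local Notation ε := (acounit adj).

(** By the second triangle identity, [f] is recovered as [fmap R (ε X ∘ fmap G f) ∘ aunit adj B]. *)
Lemma radj_ext (B : C) (X : D) (f g : hom B (R X)) :
  ε X ∘ fmap G f = ε X ∘ fmap G g -> f = g.
Proof.
move=> e; rewrite -[f]comp_idl -[g]comp_idl -(adj_triangle2 adj X) -!compA.
by rewrite !(aunit_nat adj) !compA -!(fmap_comp (functorP R)) e.
Qed.

Lemma radj_transposeK (B : C) (X : D) (f : hom (G B) X) :
  ε X ∘ fmap G (fmap R f ∘ aunit adj B) = f.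
Proof.
by rewrite strong_comp compA acounit_nat -compA adj_triangle1 comp_idr.
Qed.

Lemma radj_lax_transpose (X Y : D) :
  ε (X ⊗ Y) ∘ fmap G (radj_lax adj X Y) = (ε X ⊗₁ ε Y) ∘ oplax G (R X) (R Y).
Proof. by rewrite /radj_lax -(fmap_comp (functorP R)) radj_transposeK. Qed.

Lemma radj_lax0_transpose : ε 𝟙 ∘ fmap G (radj_lax0 adj) = oplax0 G.
Proof. exact: radj_transposeK. Qed.

Lemma lproj_transpose (A : C) (X : D) :
  ε (G A ⊗ X) ∘ fmap G (lproj adj A X) = (G A ◁ ε X) ∘ oplax G A (R X).
Proof.
rewrite /lproj strong_comp compA radj_lax_transpose -compA oplax_natr compA.
by rewrite -tensm_comp adj_triangle1 comp_idr.
Qed.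

Lemma rproj_transpose (X : D) (A : C) :
  ε (X ⊗ G A) ∘ fmap G (rproj adj X A) = (ε X ▷ G A) ∘ oplax G (R X) A.
Proof.
rewrite /rproj strong_comp compA radj_lax_transpose -compA oplax_natl compA.
by rewrite -tensm_comp adj_triangle1 comp_idr.
Qed.

(** The square linking the mates in [C] and in [D]: [oplax] carries the associator out of [G], and
    the [lax] in the transported evaluation cancels against it. *)
Lemma mate_transpose (L A B : C) (X : D) (ev : hom (L ⊗ A) 𝟙)
    (f : hom B (A ⊗ R X)) :
  ε X ∘ fmap G (mate ev f) =
  mate (oplax0 G ∘ (fmap G ev ∘ lax G L A)) (ε _ ∘ fmap G (lproj adj A X ∘ f))
    ∘ oplax G L B.
Proof.
rewrite (strong_comp G (lproj adj A X)) (compA (ε _)) lproj_transpose /mate.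
rewrite !strong_comp !lwhisk_comp !rwhisk_comp.
rewrite -!compA -oplax_natl (pre_comp (associ_nat _ _ _)) tensm_id.
rewrite -!compA (pre_comp3 (esym (oplax_associ G _ _ _))) -!compA.
rewrite (pre_comp (esym (whisk_exch (lax G L A) _))) -!compA.
rewrite (inviK (rwhisk_inv _ (oplaxP G L A))).
rewrite (pre_comp (esym (whisk_exch (fmap G ev) _))) -!compA.
rewrite (pre_comp (esym (whisk_exch (oplax0 G) _))) -!compA.
rewrite (pre_comp (lunit_nat _)) -!compA -oplax_lunit -!compA.
by rewrite (pre_comp (oplax_natr _ _ _)) -!compA.
Qed.

Lemma lproj_iso (A L : C) (X : D) : dual_pair L A -> is_iso (lproj adj A X).
Proof.
case=> ev [coev [zigzagA zigzagL]].
have mate_inj := mateK _ zigzagA.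
have mateG_inj := mateK _ (strong_zigzag G zigzagA).
have lproj_inj (B : C) (f g : hom B (A ⊗ R X)) :
    lproj adj A X ∘ f = lproj adj A X ∘ g -> f = g.
  (* It suffices to compare mates, and by [mate_transpose] their transposes agree. *)
  move=> e; rewrite -(mate_inj _ _ f) -(mate_inj _ _ g).
  by congr (comate _ _); apply: radj_ext; rewrite !mate_transpose e.
pose k := oplax0 G ∘ (fmap G ev ∘ lax G L A).
(* By [mate_transpose], an [f] with [lproj adj A X ∘ f = idm _] must have this [h] as its mate. *)
pose h := fmap R (mate k (ε (G A ⊗ X)) ∘ oplax G L _) ∘ aunit adj _.
have lprojK : lproj adj A X ∘ comate coev h = idm _.
  apply: radj_ext; rewrite strong_id comp_idr.
  (* Passing to mates in [D] makes [mate_transpose] applicable. *)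
  rewrite -[LHS]mateG_inj -[RHS]mateG_inj.
  congr (comate _ _); apply: (epi_of_inv (inv_sym (oplaxP G L _))).
  by rewrite -mate_transpose comateK // radj_transposeK.
(* A right inverse of a monomorphism is a two-sided inverse. *)
exists (comate coev h); split => //; apply: lproj_inj.
by rewrite compA lprojK comp_idl comp_idr.
Qed.

End Transposition.

(** * Reversal of the tensor product *)

(** Reversal exchanges left and right duals. The definition is transparent so that statements in the
    reversed categories convert to statements in the original ones. *)
Definition rev_monoidal (C : monoidal_category) : monoidal_category.
Proof.
refine (@MonoidalCategory C 𝟙 (fun X Y => Y ⊗ X)
  (fun X X' Y Y' f g => g ⊗₁ f)
  (fun X Y Z => associ Z Y X) (fun X Y Z => assoc Z Y X)
  runit runiti lunit luniti _ _ _ _ _ _ _ _ _ _) => *.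
- exact: tensm_id.
- exact: tensm_comp.
- exact: inv_sym (assocP _ _ _).
- exact: runitP.
- exact: lunitP.
- exact: associ_nat.
- exact: runit_nat.
- exact: lunit_nat.
- exact: triangle_lunit.
(* Both sides of the reversed pentagon invert the same map, factored in the two ways given by the
   pentagon. *)
- rewrite -[RHS]compA; apply: inverse_unique.
    exact: inverse_pair_comp (assocP _ _ _) (assocP _ _ _).
  rewrite pentagon; apply: inverse_pair_comp.
    exact: inverse_pair_comp (lwhisk_inv _ (assocP _ _ _)) (assocP _ _ _).
  exact: rwhisk_inv (assocP _ _ _).
Defined.

Definition rev_lax (C D : monoidal_category) (F : lax_data C D) :
    lax_data (rev_monoidal C) (rev_monoidal D) :=
  @LaxData (rev_monoidal C) (rev_monoidal D) F (fun X Y => lax F Y X) (lax0 F).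

Lemma rev_lax_monoidal (C D : monoidal_category)
    (G : strong_monoidal_functor C D) : is_lax_monoidal (rev_lax G).
Proof.
have laxP := strong_laxP G; split=> /=.
- exact: lax_functorP laxP.
- by move=> X X' Y Y' f g; exact: (lax_nat laxP g f).
- move=> X Y Z; apply: (epi_of_inv (assocP (G Z) (G Y) (G X))).
  rewrite -compA assocK comp_idr -compA -compA (compA (lax _ _ _)).
  rewrite (lax_assoc laxP Z Y X) !compA -strong_comp assocK.
  by rewrite strong_id comp_idl.
- exact: lax_runit laxP.
- exact: lax_lunit laxP.
Qed.

Definition rev_strong (C D : monoidal_category)
    (G : strong_monoidal_functor C D) :
    strong_monoidal_functor (rev_monoidal C) (rev_monoidal D) :=
  @StrongMonoidalFunctor (rev_monoidal C) (rev_monoidal D) (rev_lax G)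
    (rev_lax_monoidal G) (fun X Y => oplax G Y X) (oplax0 G)
    (fun X Y => oplaxP G Y X) (oplax0P G).

(* rproj is definitionally the lproj of the reversed categories. *)
Lemma rproj_iso (C D : monoidal_category) (G : strong_monoidal_functor C D)
    (R : functor D C) (adj : adjunction G R) (A L : C) (X : D) :
  dual_pair A L -> is_iso (rproj adj X A).
Proof.
case=> ev [coev [zigzagA zigzagL]].
apply: (@lproj_iso _ _ (rev_strong G) R adj A L X).
by exists ev, coev.
Qed.

(** * Lax monoidal axioms of the right adjoint *)

Section RightAdjointLax.
Variables (C D : monoidal_category) (G : strong_monoidal_functor C D).
Variables (R : functor D C) (adj : adjunction G R).
Local Notation ε := (acounit adj).
(* Abstract stand-ins for radj_lax and radj_lax0: rewriting with compA would
   unfold these. *)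
Variables (laxR : forall X Y : D, hom (R X ⊗ R Y) (R (X ⊗ Y))).
Variables (lax0R : hom 𝟙 (R 𝟙)).
Hypothesis laxR_transpose : forall X Y,
  ε (X ⊗ Y) ∘ fmap G (laxR X Y) = (ε X ⊗₁ ε Y) ∘ oplax G (R X) (R Y).
Hypothesis lax0R_transpose : ε 𝟙 ∘ fmap G lax0R = oplax0 G.

Lemma laxR_transpose_tail (X Y : D) (V : D) (t : hom V (G (R X ⊗ R Y))) :
  ε (X ⊗ Y) ∘ (fmap G (laxR X Y) ∘ t) =
  (ε X ⊗₁ ε Y) ∘ (oplax G (R X) (R Y) ∘ t).
Proof. by rewrite !compA laxR_transpose. Qed.

Lemma laxR_nat (X X' Y Y' : D) (f : hom X X') (g : hom Y Y') :
  laxR X' Y' ∘ (fmap R f ⊗₁ fmap R g) = fmap R (f ⊗₁ g) ∘ laxR X Y.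
Proof.
apply: (radj_ext (adj := adj)).
rewrite (strong_comp G (laxR _ _)) laxR_transpose_tail oplax_nat compA.
rewrite -tensm_comp !acounit_nat tensm_comp -compA -laxR_transpose.
by rewrite (strong_comp G _ (laxR _ _)) !compA acounit_nat.
Qed.

(** Both transposes are a threefold tensor of counits after iterated [oplax], so the claim reduces
    to [oplax_assoc] and naturality of the associator. *)
Lemma laxR_assoc (X Y Z : D) :
  laxR X (Y ⊗ Z) ∘ (R X ◁ laxR Y Z) ∘ assoc (R X) (R Y) (R Z) =
  fmap R (assoc X Y Z) ∘ laxR (X ⊗ Y) Z ∘ (laxR X Y ▷ R Z).
Proof.
apply: (radj_ext (adj := adj)); rewrite -!compA.
rewrite (strong_comp G (laxR _ _)) laxR_transpose_tail.
rewrite (strong_comp G (fmap R _)) (pre_comp (acounit_nat adj _)).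
rewrite (strong_comp G (laxR _ _)) -compA laxR_transpose_tail.
rewrite oplax_natr (strong_comp G (_ ◁ _)) (pre_comp (oplax_natl _ _ _)).
rewrite -compA !(compA (_ ⊗₁ _) (_ ⊗₁ _)) -!tensm_comp !laxR_transpose.
by rewrite !tensm_comp -!compA oplax_assoc (pre_comp (assoc_nat _ _ _)) -!compA.
Qed.

(** Transposes to [oplax_lunit], since [lax0R] has transpose [oplax0 G]. *)
Lemma laxR_lunit (X : D) :
  fmap R (lunit X) ∘ laxR 𝟙 X ∘ (lax0R ▷ R X) = lunit (R X).
Proof.
apply: (radj_ext (adj := adj)); rewrite -!compA.
rewrite (strong_comp G (fmap R _)) (pre_comp (acounit_nat adj _)).
rewrite (strong_comp G (laxR _ _)) -compA laxR_transpose_tail oplax_natr.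
rewrite (compA (ε _ ⊗₁ _)) -tensm_comp comp_idr lax0R_transpose.
rewrite tensm_whisk -compA (pre_comp (lunit_nat _)) -compA.
by rewrite oplax_lunit.
Qed.

Lemma laxR_runit (X : D) :
  fmap R (runit X) ∘ laxR X 𝟙 ∘ (R X ◁ lax0R) = runit (R X).
Proof.
apply: (radj_ext (adj := adj)); rewrite -!compA.
rewrite (strong_comp G (fmap R _)) (pre_comp (acounit_nat adj _)).
rewrite (strong_comp G (laxR _ _)) -compA laxR_transpose_tail oplax_natl.
rewrite (compA (ε _ ⊗₁ _)) -tensm_comp comp_idr lax0R_transpose.
rewrite tensm_whisk whisk_exch -compA (pre_comp (runit_nat _)) -compA.
by rewrite oplax_runit.
Qed.

End RightAdjointLax.

(** * Half-braidings characterized by their transposes *)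

Section HalfBraidings.
Variables (C D : monoidal_category) (G : strong_monoidal_functor C D).
Variables (R : functor D C) (adj : adjunction G R).
Local Notation ε := (acounit adj).

(* The transposed form of lproj ∘ c A = fmap R (h (G A)) ∘ rproj. *)
Definition half_transposes (X : D) (h : forall B : D, hom (X ⊗ B) (B ⊗ X))
    (c : forall A : C, hom (R X ⊗ A) (A ⊗ R X)) : Prop :=
  forall A : C,
  (G A ◁ ε X) ∘ (oplax G A (R X) ∘ fmap G (c A)) =
  h (G A) ∘ ((ε X ▷ G A) ∘ oplax G (R X) A).

(* The transposed form of the injectivity of composition with lproj A X. *)
Hypothesis lproj_cancel : forall (A : C) (X : D) (B : C) (f g : hom B (A ⊗ R X)),
  (G A ◁ ε X) ∘ (oplax G A (R X) ∘ fmap G f) =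
  (G A ◁ ε X) ∘ (oplax G A (R X) ∘ fmap G g) -> f = g.

Section OneObject.
Variables (X : D) (h : forall B : D, hom (X ⊗ B) (B ⊗ X)).
Variables (c : forall A : C, hom (R X ⊗ A) (A ⊗ R X)).
Hypotheses (hP : is_half_braiding h) (ch : half_transposes h c).

(** Transposed, this is naturality of [h] along [fmap G f]. *)
Lemma transposed_half_nat (A B : C) (f : hom A B) :
  c B ∘ (R X ◁ f) = (f ▷ R X) ∘ c A.
Proof.
apply: lproj_cancel; rewrite !strong_comp (pre_comp3 (ch B)) -!compA.
rewrite oplax_natl (pre_comp (esym (whisk_exch (ε X) _))) -!compA.
rewrite (pre_comp (half_nat hP _)) -compA (pre_comp (oplax_natr _ _ _)) -compA.
by rewrite (pre_comp (whisk_exch _ _)) -compA ch.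
Qed.

(** Transposed, this is the tensor axiom of [h] at [G A] and [G B]. *)
Lemma transposed_half_tens (A B : C) :
  c (A ⊗ B) =
  associ A B (R X) ∘ (A ◁ c B) ∘ assoc A (R X) B ∘ (c A ▷ B)
    ∘ associ (R X) A B.
Proof.
have chB := congr1 (fun f => G A ◁ f) (ch B).
have chA := congr1 (fun f => f ▷ G B) (ch A).
move: chA chB; rewrite /= !lwhisk_comp !rwhisk_comp => chA chB.
apply: lproj_cancel; rewrite ch.
(* Naturality of [h] along [oplax G A B] replaces [G (A ⊗ B)] by [G A ⊗ G B], where the tensor axiom
   applies. *)
apply: (mono_of_inv (rwhisk_inv X (inv_sym (oplaxP G A B)))).
apply: (mono_of_inv (assocP (G A) (G B) X)).
rewrite (pre_comp (esym (half_nat hP _))) -!compA.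
rewrite (pre_comp (esym (half_tens_ext' hP _ _))) extE -!compA.
rewrite [in RHS](pre_comp (esym (whisk_exch (oplax G A B) _))) -!compA.
rewrite (pre_comp (assoc_natr _ _ (ε X))) !strong_comp -!compA.
rewrite (pre_comp3 (oplax_associ G A B (R X))) -!compA (inviK (assocP _ _ _)).
rewrite (pre_comp (oplax_natl _ _ (c B))) -!compA (pre_comp3 chB) -!compA.
rewrite (pre_comp3 (oplax_assoc G A (R X) B)) -!compA.
rewrite (pre_comp (oplax_natr _ _ (c A))) -!compA.
rewrite (pre_comp (esym (assoc_nat (idm (G A)) (ε X) (idm (G B))))) -!compA.
rewrite (pre_comp3 chA) -!compA oplax_associ.
rewrite (pre_comp (esym (associ_nat _ _ _))) tensm_id -!compA.
by rewrite [in LHS](pre_comp (whisk_exch (ε X) _)) -compA.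
Qed.

(** Naturality of [h] along [oplax0 G] reduces its component at [G 𝟙] to the one at [𝟙]. *)
Lemma transposed_half_unit : c 𝟙 = luniti (R X) ∘ runit (R X).
Proof.
apply: lproj_cancel; rewrite ch.
apply: (mono_of_inv (rwhisk_inv X (inv_sym (oplax0P G)))).
apply: (mono_of_inv (lunitP X)).
rewrite (pre_comp (esym (half_nat hP _))) (half_unit hP) -!compA.
rewrite (inviK (lunitP X)) (pre_comp (whisk_exch (ε X) _)) -!compA.
rewrite (pre_comp (runit_nat _)) -!compA oplax_runit.
rewrite (pre_comp (esym (whisk_exch (oplax0 G) _))) -!compA.
rewrite (pre_comp (lunit_nat _)) strong_comp -!compA.
by rewrite (pre_comp3 (oplax_lunit G _)) -!strong_comp (inviK (lunitP _)).
Qed.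

End OneObject.

(** Naturality of the counit turns [fmap R f] into [f], which commutes with [hX] and [hY]. *)
Lemma transposed_half_mor (X Y : D) hX hY cX cY (f : hom X Y) :
  @half_transposes X hX cX -> @half_transposes Y hY cY ->
  (forall B, hY B ∘ (f ▷ B) = (B ◁ f) ∘ hX B) ->
  forall A, cY A ∘ (fmap R f ▷ A) = (A ◁ fmap R f) ∘ cX A.
Proof.
move=> cX_hX cY_hY fP A; apply: lproj_cancel; rewrite !strong_comp.
rewrite (pre_comp3 (cY_hY A)) -!compA oplax_natr.
rewrite (compA (ε Y ▷ _)) -rwhisk_comp acounit_nat rwhisk_comp -compA.
rewrite (pre_comp (fP _)) -compA -cX_hX (pre_comp (oplax_natl _ _ _)) -compA.
by rewrite [in RHS]compA -lwhisk_comp acounit_nat lwhisk_comp -compA.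
Qed.

Variables (laxR : forall X Y : D, hom (R X ⊗ R Y) (R (X ⊗ Y))).
Variables (lax0R : hom 𝟙 (R 𝟙)).
Hypothesis laxR_transpose : forall X Y,
  ε (X ⊗ Y) ∘ fmap G (laxR X Y) = (ε X ⊗₁ ε Y) ∘ oplax G (R X) (R Y).
Hypothesis lax0R_transpose : ε 𝟙 ∘ fmap G lax0R = oplax0 G.

(** The bracket on the right is the tensor product of [cZ] and [cW]; both sides transpose to
    [tens_half Z W] at [G A] after two counits and iterated [oplax]. *)
Lemma transposed_half_lax (Z W : center_ob D) cZ cW cZW :
  half_transposes (half Z) cZ -> half_transposes (half W) cW ->
  half_transposes (tens_half Z W) cZW ->
  forall A, cZW A ∘ (laxR Z W ▷ A) =
    (A ◁ laxR Z W) ∘ (assoc A (R Z) (R W) ∘ (cZ A ▷ R W)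
      ∘ associ (R Z) A (R W) ∘ (R Z ◁ cW A) ∘ assoc (R Z) (R W) A).
Proof.
move=> cZP cWP cZWP A.
have := congr1 (fun f => f ▷ G (R W)) (cZP A).
have := congr1 (fun f => G (R Z) ◁ f) (cWP A).
rewrite /= !lwhisk_comp !rwhisk_comp => chW chZ.
apply: lproj_cancel; rewrite !strong_comp (pre_comp3 (cZWP A)) -!compA oplax_natr.
rewrite (compA (ε (cob Z ⊗ cob W) ▷ _)) -rwhisk_comp laxR_transpose rwhisk_comp.
rewrite (pre_comp (oplax_natl _ _ _)) -!compA.
rewrite (compA (G A ◁ ε _)) -lwhisk_comp laxR_transpose lwhisk_comp -!compA.
(* The three associators now leave [G] one by one; between them [chZ] and [chW] turn [cZ] and [cW]
   into components of [half Z] and [half W] at [G A]. *)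
rewrite (pre_comp3 (oplax_assoc G A (R Z) (R W))) -!compA.
rewrite (pre_comp (esym (assoc_nat (idm (G A)) _ _))) -!compA.
rewrite (tensm_whisk (G A ◁ _)) (pre_comp (oplax_natr _ _ (cZ A))) -!compA.
rewrite (pre_comp3 chZ) -!compA (pre_comp3 (oplax_associ G (R Z) A (R W))) -!compA.
rewrite (pre_comp (whisk_exch (half Z (G A)) _)) -!compA.
rewrite (compA ((Z ⊗ G A) ◁ _)) -tensm_whisk.
rewrite (pre_comp (esym (associ_nat _ _ _))) -!compA.
rewrite [in RHS](tensm_whisk (ε Z)) [in RHS]whisk_exch -!compA.
rewrite (pre_comp (oplax_natl _ _ (cW A))) -!compA (pre_comp3 chW) -!compA.
rewrite oplax_assoc (pre_comp (esym (whisk_exch (ε Z) _))) -!compA.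
rewrite (pre_comp (esym (whisk_exch (ε Z) _))) -!compA.
by rewrite (pre_comp (assoc_nat _ _ _)) (tensm_whisk (ε Z)) -!compA.
Qed.

(** Once transposed and composed with the right unitor, both sides equal [fmap G (lunit A)]. *)
Lemma transposed_half_lax0 cU :
  half_transposes (@unit_half D) cU ->
  forall A, cU A ∘ (lax0R ▷ A) = (A ◁ lax0R) ∘ unit_half A.
Proof.
move=> cUP A; apply: lproj_cancel; rewrite !strong_comp (pre_comp3 (cUP A)).
rewrite -!compA oplax_natr (compA (ε 𝟙 ▷ _)) -rwhisk_comp lax0R_transpose.
rewrite (pre_comp (oplax_natl _ _ _)) -!compA.
rewrite (compA (G A ◁ ε _)) -lwhisk_comp lax0R_transpose.
apply: (mono_of_inv (runitP (G A))).
rewrite (pre_comp3 (oplax_runit G A)) /unit_half (inviK (runitP _)).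
by rewrite oplax_lunit -!strong_comp (inviK (runitP _)).
Qed.

(** The condition on [cZ] at [R W] gives [half Z] at [G (R W)]; naturality along [ε W] brings it to
    [W]. *)
Lemma transposed_half_braid (Z W : center_ob D) cZ :
  half_transposes (half Z) cZ ->
  laxR W Z ∘ cZ (R W) = fmap R (half Z W) ∘ laxR Z W.
Proof.
move=> cZP; apply: (radj_ext (adj := adj)); rewrite !strong_comp !compA.
rewrite laxR_transpose acounit_nat -!compA laxR_transpose.
rewrite tensm_whisk whisk_exch -compA cZP.
rewrite (pre_comp (esym (half_nat (halfP Z) _))) -compA.
by rewrite (compA (Z ◁ _)) -tensm_whisk.
Qed.

End HalfBraidings.

(** * The induced functor between the centers *)

Section Induced.
Variables (C D : monoidal_category) (G : strong_monoidal_functor C D).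
Variables (R : functor D C) (adj : adjunction G R).
Local Notation ε := (acounit adj).
Variable lproji : forall (A : C) (X : D), hom (R (G A ⊗ X)) (A ⊗ R X).
Hypothesis lprojiP : forall A X, inverse_pair (lproj adj A X) (lproji A X).

Lemma lproj_cancel (A : C) (X : D) (B : C) (f g : hom B (A ⊗ R X)) :
  (G A ◁ ε X) ∘ (oplax G A (R X) ∘ fmap G f) =
  (G A ◁ ε X) ∘ (oplax G A (R X) ∘ fmap G g) -> f = g.
Proof.
move=> e; apply: (mono_of_inv (lprojiP A X)); apply: (radj_ext (adj := adj)).
by rewrite !(strong_comp G (lproj adj A X)) !(compA (ε _)) lproj_transpose -!compA.
Qed.

(** Composing with [lproj] cancels the factor [lproji] of [radj_half]; the rest is transposed by
    [rproj_transpose]. *)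
Lemma radj_half_transposes (Z : center D) :
  half_transposes adj (half Z) (radj_half adj lproji Z).
Proof.
move=> A; rewrite (compA (G A ◁ _)) -lproj_transpose -compA.
rewrite -(strong_comp G (lproj adj A (cob Z))) /radj_half -compA.
rewrite (inviK (lprojiP A (cob Z))) (strong_comp G (fmap R _)).
by rewrite (pre_comp (acounit_nat adj _)) -compA rproj_transpose.
Qed.

(** Invertibility is checked on the three factors of [radj_half], the other axioms by
    transposition. *)
Lemma radj_half_braiding (Z : center D) :
  (forall X A, is_iso (rproj adj X A)) ->
  is_half_braiding (radj_half adj lproji Z).
Proof.
move=> rproj_invertible; have halfT := radj_half_transposes Z; split.
- move=> A; apply: is_iso_comp; last exact: rproj_invertible.
  apply: is_iso_comp; first exact: is_iso_of_pair (inv_sym (lprojiP _ _)).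
  exact/fmap_is_iso/(half_iso (halfP Z)).
- exact: (transposed_half_nat lproj_cancel (halfP Z) halfT).
- exact: (transposed_half_tens lproj_cancel (halfP Z) halfT).
- exact: (transposed_half_unit lproj_cancel (halfP Z) halfT).
Qed.

Hypothesis radj_halfP :
  forall Z : center D, is_half_braiding (radj_half adj lproji Z).

Lemma center_radj_fmap : center_radj_fmapP radj_halfP.
Proof.
move=> Z W f A.
exact: (transposed_half_mor lproj_cancel (radj_half_transposes Z)
  (radj_half_transposes W) (chomP f)).
Qed.

Lemma center_radj_lax : center_radj_laxP radj_halfP.
Proof.
move=> Z W A.
exact: (transposed_half_lax lproj_cancel (radj_lax_transpose adj)
  (radj_half_transposes Z) (radj_half_transposes W)
  (radj_half_transposes (Z ⊗ W))).
Qed.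

Lemma center_radj_lax0 : center_radj_lax0P radj_halfP.
Proof.
move=> A.
exact: (transposed_half_lax0 lproj_cancel (radj_lax0_transpose adj)
  (radj_half_transposes 𝟙)).
Qed.

Let ZR := center_radj_data center_radj_fmap center_radj_lax center_radj_lax0.

(** Equality in the center is equality of underlying morphisms, so every axiom is the one for
    [R]. *)
Lemma center_radj_lax_monoidal : is_lax_monoidal ZR.
Proof.
have laxT := radj_lax_transpose adj.
have lax0T := radj_lax0_transpose adj.
split=> *; try apply: center_hom_eq.
- split=> *; apply: center_hom_eq.
    exact: (fmap_id (functorP R)).
  exact: (fmap_comp (functorP R)).
- exact: (laxR_nat laxT).
- exact: (laxR_assoc laxT).
- exact: (laxR_lunit laxT lax0T).
- exact: (laxR_runit laxT lax0T).
Qed.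

Lemma center_radj_braided (Z W : center D) :
  lax ZR W Z ∘ braid (ZR Z) (ZR W) = fmap ZR (braid Z W) ∘ lax ZR Z W.
Proof.
apply: center_hom_eq.
exact (transposed_half_braid (radj_lax_transpose adj) W
  (radj_half_transposes Z)).
Qed.

End Induced.

(** * Existence of the braided lax monoidal functor *)

Theorem theorem1 (C D : monoidal_category) (G : strong_monoidal_functor C D)
    (R : functor D C) (adj : adjunction G R) (rigidC : rigid C) :
  exists ZR : braided_lax_monoidal_functor (center D) (center C),
    induced_by_radj adj ZR.
Proof.
have lproj_invertible A X : is_iso (lproj adj A X).
  (* [lproj] uses a left dual of [A], and [rproj] below a right dual. *)
  by have [[L LA] _] := rigidC A; apply: lproj_iso LA.
have rproj_invertible X A : is_iso (rproj adj X A).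
  by have [_ [L AL]] := rigidC A; apply: rproj_iso AL.
(* Being invertible is a mere existence statement, so a family of inverses is chosen by indefinite
   description. *)
pose lproji A X :=
  proj1_sig (constructive_indefinite_description _ (lproj_invertible A X)).
have lprojiP A X : inverse_pair (lproj adj A X) (lproji A X).
  exact: proj2_sig (constructive_indefinite_description _ _).
pose radj_halfP Z := radj_half_braiding lprojiP Z rproj_invertible.
exists (BraidedLaxMonoidalFunctor
  (center_radj_lax_monoidal lprojiP radj_halfP)
  (center_radj_braided lprojiP radj_halfP)).
by exists lproji, radj_halfP, (center_radj_fmap lprojiP radj_halfP),
  (center_radj_lax lprojiP radj_halfP), (center_radj_lax0 lprojiP radj_halfP).
Qed.
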